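(* Let $\Gamma=(V,E)$ be any finite digraph without parallel edges. Then $$|T(\Gamma)|\geq |E|.$$
   Context: A finite digraph without parallel edges is a pair $\Gamma=(V,E)$ with $V=\{v_1,\ldots,v_n\}$ a finite set and $E\subseteq V\times V$ a set of ordered pairs (loops $(v_i,v_i)$ are allowed, and both $(v_i,v_j)$ and $(v_j,v_i)$ may belong to $E$). For $v_i\in V$ set $D^-(v_i)=\{v_j\in V\mid (v_j,v_i)\in E\}$ and $D^+(v_i)=\{v_j\in V\mid (v_i,v_j)\in E\}$. Two vertices $v_i,v_j\in V$ (possibly equal) are mutually neighbored if $D^-(v_i)\cap D^-(v_j)\neq\emptyset$ or $D^+(v_i)\cap D^+(v_j)\neq\emptyset$. Define $$T(\Gamma)=E\circ E^{\mathrm{op}}\cup E^{\mathrm{op}}\circ E=\{(v_i,v_j)\in V\times V\mid v_i,v_j \text{ are mutually neighbored}\},$$ a set of ordered pairs, where $E^{\mathrm{op}}=\{(v,u)\mid (u,v)\in E\}$ and $\circ$ is composition of relations. *)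

(* Defs.v *)
From mathcomp Require Import all_boot.

Set Implicit Arguments.
Unset Strict Implicit.
Unset Printing Implicit Defensive.

(* A finite digraph without parallel edges is given by its vertex type
   V : finType and its edge set E : {set V * V}; loops are allowed. *)

Definition relop (V : finType) (E : {set V * V}) : {set V * V} :=
  [set p | (p.2, p.1) \in E].

(* Right-to-left composition. The opposite convention only swaps the two terms
   of the union defining mutualT. *)
Definition relcomp (V : finType) (F G : {set V * V}) : {set V * V} :=
  [set p | [exists w, ((p.1, w) \in G) && ((w, p.2) \in F)]].

Definition inNeighbors (V : finType) (E : {set V * V}) (v : V) : {set V} :=
  [set w | (w, v) \in E].

Definition outNeighbors (V : finType) (E : {set V * V}) (v : V) : {set V} :=
  [set w | (v, w) \in E].

Definition mutuallyNeighbored (V : finType) (E : {set V * V}) (u v : V) : bool :=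
  (inNeighbors E u :&: inNeighbors E v != set0)
  || (outNeighbors E u :&: outNeighbors E v != set0).

Definition mutualT (V : finType) (E : {set V * V}) : {set V * V} :=
  relcomp E (relop E) :|: relcomp (relop E) E.

Lemma mutualTE (V : finType) (E : {set V * V}) :
  mutualT E = [set p | mutuallyNeighbored E p.1 p.2].
Proof.
apply/setP=> -[u v]; rewrite !inE /=; congr (_ || _).
  by apply/existsP/set0Pn=> -[w]; rewrite !inE => Hw; exists w; rewrite !inE.
by apply/existsP/set0Pn=> -[w]; rewrite !inE => Hw; exists w; rewrite !inE.
Qed.

(* Main.v *)
Require Import Defs.
From mathcomp Require Import all_boot.
From mathcomp Require Import all_order all_algebra ring lra.

Set Implicit Arguments.
Unset Strict Implicit.
Unset Printing Implicit Defensive.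

(** If [(x, y)] is an edge, then all in-neighbours of [y] are mutually
    neighboured with [x], and all out-neighbours of [x] are mutually neighboured
    with [y]. Writing [t v] for the number of pairs of T with first coordinate
    [v], this gives [t x >= d^-(y)] and [t y >= d^+(x)]. As [a / b + b / a >= 2],
    summing over the edges yields
    [2 |E| <= \sum_(x, y) (d^-(y) / d^+(x) + d^+(x) / d^-(y))
           <= \sum_(x, y) (t x / d^+(x) + t y / d^-(y)) <= 2 |T|]. *)

Import Order.TTheory GRing.Theory Num.Theory.

Local Open Scope ring_scope.

(** On an edge set, the fibers of [fst] and [snd] over [v] have d^+(v) and d^-(v) elements; on
    [mutualT E], that of [fst] has t v. *)
Definition fiber (T I : finType) (f : T -> I) (A : {set T}) (i : I) : {set T} :=
  [set p in A | f p == i].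

Lemma sum_card_fiber (T I : finType) (f : T -> I) (A : {set T}) :
  (\sum_i #|fiber f A i| = #|A|)%N.
Proof.
rewrite -sum1_card (partition_big f predT) //=.
by apply: eq_bigr => i _; rewrite -sum1_card; apply: eq_bigl => p; rewrite inE.
Qed.

(** A nonempty fiber repeats the same quotient as often as its denominator says, which gives [h i];
    an empty one gives 0, hence only an inequality. *)
Lemma sum_div_fiber_le (T I : finType) (f : T -> I) (A : {set T})
    (h : I -> nat) :
  \sum_(p in A) (h (f p))%:R / #|fiber f A (f p)|%:R
    <= (\sum_i h i)%:R :> rat.
Proof.
rewrite natr_sum (partition_big f predT) //=; apply: ler_sum => i _.
rewrite (eq_bigr (fun=> (h i)%:R / #|fiber f A i|%:R)); last first.
  by move=> p /andP[_ /eqP ->].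
rewrite (eq_bigl [in fiber f A i]); last by move=> p; rewrite inE.
rewrite sumr_const -(mulr_natr (_ / _)).
have [->|nz] := eqVneq #|fiber f A i| 0%N; first by rewrite mulr0 ler0n.
by rewrite divfK // pnatr_eq0.
Qed.

Lemma ge2_div_add_div (F : realFieldType) (a b : F) :
  0 < a -> 0 < b -> 2 <= a / b + b / a.
Proof.
move=> a0 b0; rewrite -subr_ge0.
have -> : a / b + b / a - 2 = (a - b) ^+ 2 / (a * b).
  by field; rewrite !gt_eqF.
by rewrite divr_ge0 ?sqr_ge0 // mulr_ge0 // ltW.
Qed.

Lemma card_in_fiber_le (V : finType) (E : {set V * V}) (x y : V) :
  (x, y) \in E -> (#|fiber snd E y| <= #|fiber fst (mutualT E) x|)%N.
Proof.
move=> xy; have inj : {in fiber snd E y &, injective (fun p => (x, p.1))}.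
  move=> [a b] [c d]; rewrite !inE /= => /andP[_ /eqP ->] /andP[_ /eqP ->].
  by case=> ->.
rewrite -(card_in_imset inj); apply/subset_leq_card/subsetP=> q /imsetP[[w z]].
rewrite !inE /= => /andP[wz /eqP zy] -> /=; rewrite {z}zy in wz *.
(* [y] is a common out-neighbour of [x] and [w]. *)
rewrite eqxx andbT; apply/orP; right.
by apply/existsP; exists y; rewrite xy inE.
Qed.

Lemma card_out_fiber_le (V : finType) (E : {set V * V}) (x y : V) :
  (x, y) \in E -> (#|fiber fst E x| <= #|fiber fst (mutualT E) y|)%N.
Proof.
move=> xy; have inj : {in fiber fst E x &, injective (fun p => (y, p.2))}.
  move=> [a b] [c d]; rewrite !inE /= => /andP[_ /eqP ->] /andP[_ /eqP ->].
  by case=> ->.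
rewrite -(card_in_imset inj); apply/subset_leq_card/subsetP=> q /imsetP[[z w]].
rewrite !inE /= => /andP[zw /eqP zx] -> /=; rewrite {z}zx in zw *.
(* Dually, [x] is a common in-neighbour of [y] and [w]. *)
rewrite eqxx andbT; apply/orP; left.
by apply/existsP; exists x; rewrite inE xy.
Qed.

Local Close Scope ring_scope.
Unset Implicit Arguments.

Theorem theoremA (V : finType) (E : {set V * V}) : #|mutualT E| >= #|E|.
Proof.
pose t v := #|fiber fst (mutualT E) v|.
have := sum_div_fiber_le fst E t; have := sum_div_fiber_le snd E t.
rewrite {}/t sum_card_fiber => le_in le_out.
suff : (2 * #|E|%:R <= #|mutualT E|%:R + #|mutualT E|%:R :> rat)%R.
  by rewrite -(ler_nat rat); lra.
(* Writing the left side as a sum of 2 over the edges reduces the claim to one inequality per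
   edge. *)
apply: le_trans (lerD le_out le_in); rewrite mulr_natr -sumr_const -big_split /=.
apply: ler_sum => -[x y] xy /=.
have out_gt0 : 0 < #|fiber fst E x|.
  by apply/card_gt0P; exists (x, y); rewrite inE xy /=.
have in_gt0 : 0 < #|fiber snd E y|.
  by apply/card_gt0P; exists (x, y); rewrite inE xy /=.
apply: le_trans (@ge2_div_add_div rat #|fiber snd E y|%:R #|fiber fst E x|%:R _ _) _;
  rewrite ?ltr0n //.
apply: lerD; rewrite ler_pM2r ?invr_gt0 ?ltr0n // ler_nat.
- exact: card_in_fiber_le.
- exact: card_out_fiber_le.
Qed.
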